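(* Let $f$ be a multiplicative graph invariant and let $G=H_1\sqcup\cdots\sqcup H_k$ with $k\geq 1$. If $f(H_j)\notin\{0,1\}$ for $j=1,\dots,k$, then $$vs_f(G)=\min\{vs_f(H_j),\,|V(H_j)| : j=1,\dots,k\}.$$
   Context: All graphs are finite and simple (the graph with no vertices is allowed). An invariant is a function $f$ from graphs to $[0,\infty)$ that is constant on isomorphism classes. $\sqcup$ denotes disjoint union of graphs. $f$ is multiplicative if $f(H_1\sqcup H_2)=f(H_1)\cdot f(H_2)$ for all disjoint graphs $H_1,H_2$. The $f$-vertex stability number is $vs_f(G)=\min\{|X|: X\subseteq V(G),\ f(G-X)\neq f(G)\}$, and $vs_f(G)=\infty$ if $f(G-X)=f(G)$ for all $X\subseteq V(G)$ ($X=V(G)$ is allowed). *)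

(* Defs.v *)
From HB Require Import structures.
From mathcomp Require Import all_boot all_order all_algebra.
From mathcomp Require Import all_classical all_reals.

Set Implicit Arguments.
Unset Strict Implicit.
Unset Printing Implicit Defensive.

Import Order.TTheory GRing.Theory Num.Theory.
Local Open Scope ring_scope.

Record graph : Type := Graph {
  vertex :> finType;
  edge : rel vertex;
  edge_sym : symmetric edge;
  edge_irrefl : irreflexive edge }.

Definition graph_iso (G H : graph) : Prop :=
  exists2 h : G -> H, bijective h & forall x y, edge (h x) (h y) = edge x y.

Section Delete.
Variables (G : graph) (X : {set G}).

Let VX : finType := {x : G | x \notin X}.
Definition delete_edge : rel VX := fun x y => edge (val x) (val y).

Lemma delete_edge_sym : symmetric delete_edge.
Proof. by move=> x y; apply: edge_sym. Qed.

Lemma delete_edge_irrefl : irreflexive delete_edge.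
Proof. by move=> x; apply: edge_irrefl. Qed.

Definition delete : graph := Graph delete_edge_sym delete_edge_irrefl.

End Delete.

Section DisjointUnion.
Variables H1 H2 : graph.

Definition union_edge : rel (H1 + H2)%type := fun u v =>
  match u, v with
  | inl x, inl y => edge x y
  | inr x, inr y => edge x y
  | _, _ => false
  end.

Lemma union_edge_sym : symmetric union_edge.
Proof. by move=> [x|x] [y|y] //=; apply: edge_sym. Qed.

Lemma union_edge_irrefl : irreflexive union_edge.
Proof. by move=> [x|x] /=; apply: edge_irrefl. Qed.

Definition disjoint_union : graph := Graph union_edge_sym union_edge_irrefl.

End DisjointUnion.

Section BigDisjointUnion.
Variables (k : nat) (H : 'I_k -> graph).

(* [tagged_as u v] is the second component of [v] cast to the type of that of
   [u], which is meaningful because the tags are tested for equality first. *)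
Definition bigunion_edge : rel {i : 'I_k & H i} := fun u v =>
  (tag u == tag v) && edge (tagged u) (tagged_as u v).

Lemma bigunion_edge_sym : symmetric bigunion_edge.
Proof.
move=> [i x] [j y]; rewrite /bigunion_edge /= eq_sym.
by case: eqP => //= eq_ji; case: _ / eq_ji x => x; rewrite !tagged_asE edge_sym.
Qed.

Lemma bigunion_edge_irrefl : irreflexive bigunion_edge.
Proof. by move=> [i x]; rewrite /bigunion_edge /= eqxx tagged_asE edge_irrefl. Qed.

Definition big_disjoint_union : graph :=
  Graph bigunion_edge_sym bigunion_edge_irrefl.

End BigDisjointUnion.

Section Invariants.
Variable R : realType.
Implicit Type f : graph -> R.

Definition graph_invariant f : Prop :=
  (forall G, 0 <= f G) /\ (forall G H, graph_iso G H -> f G = f H).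

Definition graph_multiplicative f : Prop :=
  forall H1 H2, f (disjoint_union H1 H2) = f H1 * f H2.

(* The value lies in the naturals extended by infinity, seen inside [\bar R];
   the minimum over an empty family is [+oo]. *)
Definition vs f (G : graph) : \bar R :=
  \big[Order.min/+oo%E]_(X : {set G} | f (delete X) != f G) (#|X|%:R)%:E.

End Invariants.

(* Main.v *)
Require Import Defs.
From HB Require Import structures.
From mathcomp Require Import all_boot all_order all_algebra.
From mathcomp Require Import all_classical all_reals.

Set Implicit Arguments.
Unset Strict Implicit.
Unset Printing Implicit Defensive.

Import Order.TTheory GRing.Theory Num.Theory.
Local Open Scope ring_scope.

(** For [X] contained in [V(G)], [G - X] is the disjoint union of the
[H_j - X_j] with [X_j] the part of [X] in [H_j], so [f(G - X)] is the product
of the [f(H_j - X_j)]. As all [f(H_j)] are nonzero, changing [f] on a single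
component changes [f(G)], and conversely [f(G - X) <> f(G)] forces
[f(H_j - X_j) <> f(H_j)] for some [j]. A nonzero value also forces
[f = 1] on the empty graph; since [f(H_j) <> 1], deleting all of [V(H_j)]
changes [f(H_j)], whence [vs_f(H_j) <= |V(H_j)|] and the terms [|V(H_j)|] do not
affect the minimum. *)

(** Choice supplies the inverse, which spares the isomorphisms below an explicit inverse on
    dependent pairs. *)
Lemma inj_surj_bijective (A B : Type) (h : A -> B) :
  injective h -> (forall y, exists x, h x = y) -> bijective h.
Proof.
move=> h_inj /choice[g hg]; exists g => // x.
by apply: h_inj; rewrite hg.
Qed.

Lemma bigunion_edgeT (k : nat) (H : 'I_k -> graph) (i : 'I_k)
    (x y : H i) :
  bigunion_edge (Tagged H x) (Tagged H y) = edge x y.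
Proof. by rewrite /bigunion_edge /= eqxx tagged_asE. Qed.

Lemma bigunion_edgeF (k : nat) (H : 'I_k -> graph) (i j : 'I_k)
    (x : H i) (y : H j) :
  i != j -> bigunion_edge (Tagged H x) (Tagged H y) = false.
Proof. by rewrite /bigunion_edge /= => /negPf->. Qed.

Lemma Tagged_inj (I : eqType) (T : I -> eqType) (i : I) :
  injective (@Tagged I i T).
Proof. by move=> x y /eqP; rewrite eq_Tagged => /eqP. Qed.

Lemma disjoint_union_empty_iso (H E : graph) :
  (E -> False) -> graph_iso H (disjoint_union H E).
Proof.
move=> E0; exists (inl : H -> disjoint_union H E) => //.
apply: inj_surj_bijective => [x y [] //|[x|/E0 []]].
by exists x.
Qed.

Lemma delete0_iso (G : graph) : graph_iso (delete (finset.set0 : {set G})) G.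
Proof.
exists (val : delete (finset.set0 : {set G}) -> G) => //.
apply: inj_surj_bijective => [|x]; first exact: val_inj.
have x0 : x \notin (finset.set0 : {set G}) by rewrite inE.
by exists (Sub x x0).
Qed.

(** Splitting off the component [ord0] lets binary multiplicativity be iterated by induction on
    [k]. *)
Lemma big_disjoint_unionS_iso (k : nat) (H : 'I_k.+1 -> graph) :
  graph_iso
    (disjoint_union (H ord0) (big_disjoint_union (fun i => H (lift ord0 i))))
    (big_disjoint_union H).
Proof.
pose h (u : disjoint_union (H ord0)
              (big_disjoint_union (fun i => H (lift ord0 i)))) :
    big_disjoint_union H :=
  match u with
  | inl x => Tagged H x
  | inr v => @Tagged _ (lift ord0 (tag v)) H (tagged v)
  end.
exists h.
  apply: inj_surj_bijective => [[x|[i x]] [y|[j y]] /= e|[i x]].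
  - by rewrite (Tagged_inj e).
  - by have /= := congr1 tag e.
  - by have /= := congr1 tag e.
  - have /lift_inj eij : lift ord0 i = lift ord0 j := congr1 tag e.
    (* The second components share a type only once the tags are identified, so [eij] is eliminated
       before [Tagged_inj] is used. *)
    by case: _ / eij y e => y e; rewrite (Tagged_inj e).
  - case: (unliftP ord0 i) => [j|] ei; move: x; rewrite ei => x.
    + by exists (inr (@Tagged _ j (fun i => H (lift ord0 i)) x)).
    + by exists (inl x).
case=> [x|[i x]] [y|[j y]] /=; try by rewrite bigunion_edgeF.
  by rewrite bigunion_edgeT.
have [eij|nij] := eqVneq i j.
  by case: _ / eij y => y; rewrite !bigunion_edgeT.
by rewrite !bigunion_edgeF ?(inj_eq (@lift_inj _ _)).
Qed.

Definition part (k : nat) (H : 'I_k -> graph)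
    (X : {set big_disjoint_union H}) (j : 'I_k) : {set H j} :=
  [set x | (Tagged H x : big_disjoint_union H) \in X].

(** Both graphs live on the tagged vertices outside [X]; only the nesting of the tag and the
    non-membership proof differs. *)
Lemma delete_big_disjoint_union_iso (k : nat) (H : 'I_k -> graph)
    (X : {set big_disjoint_union H}) :
  graph_iso (big_disjoint_union (fun j => delete (part X j))) (delete X).
Proof.
have hP (u : big_disjoint_union (fun j => delete (part X j))) :
    (Tagged H (val (tagged u)) : big_disjoint_union H) \notin X.
  by case: u => j [x /=]; rewrite inE.
exists (fun u => exist (fun x => x \notin X) _ (hP u) : delete X).
  apply: inj_surj_bijective => [[i x] [j y] /(congr1 val) /= e|[[i x] xX]].
    have eij : i = j := congr1 tag e.
    case: _ / eij y e => y e.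
    by have /val_inj -> := Tagged_inj e.
  have x' : x \notin part X i by rewrite inE.
  exists (@Tagged _ i (fun j => delete (part X j)) (exist _ x x')).
  exact: val_inj.
move=> [i x] [j y].
rewrite [LHS]/(bigunion_edge (Tagged H (val x)) (Tagged H (val y))).
have [eij|/eqP nij] := pselect (i = j).
  case: _ / eij y => y.
  by apply: etrans (bigunion_edgeT _ _) _; apply/esym/bigunion_edgeT.
by apply: etrans (bigunion_edgeF _ _ nij) _; apply/esym/bigunion_edgeF.
Qed.

Lemma card_part (k : nat) (H : 'I_k -> graph)
    (X : {set big_disjoint_union H}) (j : 'I_k) : (#|part X j| <= #|X|)%N.
Proof.
rewrite -(card_imset _ (@Tagged_inj _ H j)).
by apply/subset_leq_card/fintype.subsetP => _ /imsetP[x + ->]; rewrite inE.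
Qed.

Section Component.
Variables (k : nat) (H : 'I_k -> graph) (j : 'I_k) (X : {set H j}).

(** Transports a deletion set of one component to the whole union, leaving the other components
    intact. *)
Definition component_set : {set big_disjoint_union H} :=
  [set (Tagged H x : big_disjoint_union H) | x in X].

Lemma card_component_set : #|component_set| = #|X|.
Proof. exact: (card_imset _ (@Tagged_inj _ H j)). Qed.

Lemma part_component_set : part component_set j = X.
Proof.
by apply/setP => x; rewrite inE (mem_imset _ _ (@Tagged_inj _ H j)).
Qed.

Lemma part_component_set_neq (i : 'I_k) :
  i != j -> part component_set i = finset.set0.
Proof.
move=> nij; apply/setP => x; rewrite !inE; apply/imsetP => -[y _ e].
by have /= ij := congr1 tag e; rewrite ij eqxx in nij.
Qed.

End Component.

Section Invariant.
Variables (R : realType) (f : graph -> R).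
Hypotheses (f_inv : graph_invariant f) (f_mul : graph_multiplicative f).

(** Adding the vertexless [E] to [H] gives [f H * f E = f H], and [f H] cancels. *)
Lemma invariant_empty (H E : graph) : f H != 0 -> (E -> False) -> f E = 1.
Proof.
move=> fH E0; apply: (mulfI fH); rewrite mulr1 -f_mul; apply/esym/f_inv.2.
exact: disjoint_union_empty_iso.
Qed.

Lemma invariant_delete0 (G : graph) : f (delete (finset.set0 : {set G})) = f G.
Proof. exact/f_inv.2/delete0_iso. Qed.

(** The value 1 on vertexless graphs matches the empty product, so the induction can start at
    [k = 0]. *)
Lemma invariant_big_disjoint_union (k : nat) (H : 'I_k -> graph) :
  (forall E : graph, (E -> False) -> f E = 1) ->
  f (big_disjoint_union H) = \prod_(j < k) f (H j).
Proof.
move=> f1; elim: k H => [|k IHk] H.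
  by rewrite big_ord0; apply: f1 => -[[]].
by rewrite -(f_inv.2 _ _ (big_disjoint_unionS_iso H)) f_mul IHk big_ord_recl.
Qed.

Lemma vs_le_card (G : graph) :
  f G \notin [:: 0; 1] -> (vs f G <= (#|G|%:R)%:E)%O.
Proof.
rewrite !inE negb_or => /andP[fG0 fG1].
(* The witness is the full vertex set: deleting it leaves no vertex, hence the value 1. *)
rewrite -cardsT; apply: bigmin_le_cond.
rewrite (@invariant_empty G) //; first by rewrite eq_sym.
by move=> [x]; rewrite inE.
Qed.

End Invariant.

Theorem theorem2p4 (R : realType) (f : graph -> R)
  (f_inv : graph_invariant f) (f_mul : graph_multiplicative f)
  (k : nat) (k_ge1 : (1 <= k)%N) (H : 'I_k -> graph)
  (fH : forall j : 'I_k, f (H j) \notin [:: 0; 1]) :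
  vs f (big_disjoint_union H) =
  \big[Order.min/+oo%E]_(j < k) Order.min (vs f (H j)) (#|H j|%:R)%:E.
Proof.
have fH0 j : f (H j) != 0.
  by have := fH j; rewrite !inE negb_or => /andP[].
have f1 (E : graph) : (E -> False) -> f E = 1.
  (* As [k] is positive, component 0 exists and provides a nonzero value to cancel. *)
  exact: (invariant_empty f_inv f_mul (fH0 (Ordinal k_ge1))).
have fG := invariant_big_disjoint_union f_inv f_mul H f1.
have fGX (X : {set big_disjoint_union H}) :
    f (delete X) = \prod_(j < k) f (delete (part X j)).
  rewrite -(f_inv.2 _ _ (delete_big_disjoint_union_iso X)).
  exact: invariant_big_disjoint_union.
under eq_bigr do rewrite (min_idPl (vs_le_card f_inv f_mul (fH _))).
apply/eqP; rewrite eq_le; apply/andP; split.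
  apply: le_bigmin => [|j _]; first exact: leey.
  apply: le_bigmin => [|X fX]; first exact: leey.
  rewrite -card_component_set; apply: bigmin_le_cond.
  (* Outside [j] the factors are unchanged and nonzero, so their product cancels and only the change
     at [j] remains. *)
  rewrite fG fGX (bigD1 j) //= [X in _ != X](bigD1 j) //=.
  rewrite part_component_set.
  under eq_bigr => i nij do
    rewrite part_component_set_neq // invariant_delete0 //.
  by rewrite (inj_eq (mulIf _)) //; apply/prodf_neq0.
apply: le_bigmin => [|X]; first exact: leey.
rewrite fG fGX => fX.
(* If every factor kept its value, so would the product. The component [j] found here gives the
   chain from [vs f (H j)] through [#|part X j|] to [#|X|]. *)
have /existsP[j fXj] : [exists j, f (delete (part X j)) != f (H j)].
  apply: contraNT fX; rewrite negb_exists => /forallP e.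
  by apply/eqP/eq_bigr => j _; apply/eqP; rewrite -[_ == _]negbK e.
apply: (@le_trans _ _ (vs f (H j))); first exact: bigmin_le_cond.
apply: (@le_trans _ _ (#|part X j|%:R)%:E); first exact: bigmin_le_cond.
by rewrite lee_fin ler_nat card_part.
Qed.
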